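(* Let $t \ge 2$ be an integer. For all graphs $G$ of girth at least $2t+1$ and maximum degree at most $\Delta$ it holds that $\chi'_t(G) = O(\Delta^t/\log \Delta)$ as $\Delta\to\infty$. That is, there exist constants $C>0$ and $\Delta_0 \ge 2$, depending only on $t$, such that for every integer $\Delta \ge \Delta_0$ and every graph $G$ of girth at least $2t+1$ and maximum degree at most $\Delta$, $\chi'_t(G) \le C\,\Delta^t/\log\Delta$.
   Context: Graphs are finite and have no loops or parallel edges. The girth of a graph is the length of its shortest cycle ($\infty$ if it has no cycle). The distance between two distinct edges of a graph $G$ is the number of vertices in a shortest path between them (so adjacent edges have distance $1$); equivalently, it is their distance as vertices of the line graph $L(G)$. A distance-$t$ edge-colouring of $G$ is a colouring of the edges of $G$ such that no two distinct edges at distance at most $t$ receive the same colour. The distance-$t$ chromatic index $\chi'_t(G)$ is the least integer $k$ such that $G$ has a distance-$t$ edge-colouring using $k$ colours; equivalently, it is the chromatic number of the $t$-th power of $L(G)$. *)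

(* Defs.v *)
From mathcomp Require Import all_boot.

Set Implicit Arguments.
Unset Strict Implicit.
Unset Printing Implicit Defensive.

Record sgraph := SGraph {
  vertex :> finType;
  adj : rel vertex;
  adj_sym : symmetric adj;
  adj_irrefl : irreflexive adj }.

(* [option nat] stands for the natural numbers extended with [None] as
   infinity; [leo] is the usual order on it. *)
Definition leo (x y : option nat) : bool :=
  match x, y with
  | _, None => true
  | None, Some _ => false
  | Some m, Some n => m <= n
  end.

(* The least [n] with [P n], or infinity if there is none. Only [n <= b] are
   inspected, so [b] must bound every [n] satisfying [P]. *)
Definition least (b : nat) (P : pred nat) : option nat :=
  if has P (iota 0 b.+1) then Some (find P (iota 0 b.+1)) else None.

Section Graph.
Variable G : sgraph.

Definition max_degree : nat := \max_(x : G) #|[set y | adj x y]|.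

Definition girth : option nat :=
  least #|G| (fun n =>
    (2 < n) && [exists s : n.-tuple G, ucycleb (@adj G) s]).

Definition edge_set : {set {set G}} :=
  [set A : {set G} | [exists x, exists y, adj x y && (A == [set x; y])]].

Definition edge : finType := {A : {set G} | A \in edge_set}.

Definition edge_path (e f : edge) (s : seq G) : bool :=
  if s is x :: p then
    [&& x \in val e, last x p \in val f, path (@adj G) x p & uniq s]
  else false.

(* The length of a path between edges is its number of vertices. This is the
   distance in the line graph when [e != f]; [edge_dist e e = Some 1]. *)
Definition edge_dist (e f : edge) : option nat :=
  least #|G| (fun n => [exists s : n.-tuple G, edge_path e f s]).

Definition dist_edge_colouring (t k : nat) (c : {ffun edge -> 'I_k}) : bool :=
  [forall e, forall f,
     (e != f) && leo (edge_dist e f) (Some t) ==> (c e != c f)].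

Definition dist_edge_colourable (t k : nat) : bool :=
  [exists c : {ffun edge -> 'I_k}, dist_edge_colouring t c].

Lemma dist_edge_colourable_ex (t : nat) : exists k, dist_edge_colourable t k.
Proof.
exists #|edge|; apply/existsP; exists [ffun e => enum_rank e].
apply/forallP=> e; apply/forallP=> f; apply/implyP=> /andP[nef _].
by rewrite !ffunE (inj_eq enum_rank_inj).
Qed.

Definition dist_chromatic_index (t : nat) : nat :=
  ex_minn (dist_edge_colourable_ex t).

End Graph.

Variant least_spec (P : pred nat) : option nat -> Set :=
  | LeastSome n of P n & (forall m, P m -> n <= m) : least_spec P (Some n)
  | LeastNone of (forall m, ~~ P m) : least_spec P None.

Lemma leastP b (P : pred nat) :
  (forall n, P n -> n <= b) -> least_spec P (least b P).
Proof.
rewrite /least; move: (iota 0 b.+1) (mem_iota 0 b.+1) (nth_iota 0 0 (n := b.+1))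
  (size_iota 0 b.+1) => s ms ns szs Pb.
case: ifPn => [hP|nP]; constructor.
- by have := nth_find 0 hP; rewrite ns // -szs -has_find.
- move=> m Pm; rewrite leqNgt; apply/negP=> lt_m.
  have := before_find 0 lt_m; rewrite ns ?add0n ?Pm //.
  by apply: leq_trans lt_m _; rewrite -ltnS -szs ltnS find_size.
- move=> m; apply/negP=> Pm; case/hasP: nP; exists m => //.
  by rewrite ms add0n ltnS Pb.
Qed.

Lemma least_leP b (P : pred nat) t : (forall n, P n -> n <= b) ->
  reflect (exists2 n, n <= t & P n) (leo (least b P) (Some t)).
Proof.
case/leastP=> [n Pn min_n|nP] /=.
  by apply: (iffP idP) => [|[m le_mt /min_n/leq_trans->]//]; exists n.
by right=> -[n _]; rewrite (negPf (nP n)).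
Qed.

Lemma least_geP b (P : pred nat) m : (forall n, P n -> n <= b) ->
  reflect (forall n, P n -> m <= n) (leo (Some m) (least b P)).
Proof.
case/leastP=> [n Pn min_n|nP] /=.
  by apply: (iffP idP) => [le_mn k /min_n|->//]; apply: leq_trans.
by left=> n; rewrite (negPf (nP n)).
Qed.

Lemma uniq_size_card (T : finType) (s : seq T) : uniq s -> size s <= #|T|.
Proof. by move=> /card_uniqP <-; apply: max_card. Qed.

Lemma girth_geP (G : sgraph) m :
  reflect (forall s : seq G, 2 < size s -> ucycle (@adj G) s -> m <= size s)
          (leo (Some m) (girth G)).
Proof.
apply: (iffP (least_geP _ _)) => [n /andP[_ /existsP[s /andP[_ us]]]|H s s2 cs|].
- by rewrite -(size_tuple s) uniq_size_card.
- by apply: H; rewrite s2; apply/existsP; exists (in_tuple s).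
by move=> H n /andP[n2 /existsP[s cs]]; rewrite -(size_tuple s) H ?size_tuple.
Qed.

Lemma edge_dist_leP (G : sgraph) (e f : edge G) t :
  reflect (exists2 s, size s <= t & edge_path e f s)
          (leo (edge_dist e f) (Some t)).
Proof.
apply: (iffP (least_leP _ _)) => [n /existsP[s]|[n nt /existsP[s es]]|[s st es]].
- rewrite -[X in X <= _](size_tuple s) /edge_path.
  by case: (tval s) => // x p /and4P[_ _ _]; apply: uniq_size_card.
- by exists s => //; rewrite size_tuple.
by exists (size s) => //; apply/existsP; exists (in_tuple s).
Qed.

(* Main.v *)
(* Let [E] be the relation "distance at most t" on edges. By the girth hypothesis, a
   vertex outside [ball u k] has at most one neighbour in [ball u k.+1] when
   [k.+2 <= t]; hence two disjoint edges have only O(Delta^(t-1)) common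
   [E]-neighbours, while [E]-degrees are O(Delta^t). Such locally sparse relations
   are coloured with q = C Delta^t / ln Delta colours by Rosenfeld's counting
   argument: one proves by induction that adding a vertex [v] to [S] multiplies the
   number of proper colourings of [S] by at least l = Delta^(t-1/4). In a uniformly
   random proper colouring of [S], the induction hypothesis makes it unlikely that a
   given neighbour of [v] has few available colours. The remaining neighbours, being
   sparsely related to one another, avoid a given colour almost independently, so
   by convexity of the exponential about q exp(-4D/q) colours are expected to
   remain available at [v]. *)
Require Import Defs.
From mathcomp Require Import all_boot all_order all_algebra.
From mathcomp Require Import reals exp.
From mathcomp Require Import sequences zify ring lra.
Import Order.TTheory GRing.Theory Num.Theory.
Local Open Scope ring_scope.

Set Implicit Arguments.
Unset Strict Implicit.
Unset Printing Implicit Defensive.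

(** * Recolouring one vertex *)

Section Recolouring.
Variables (V : finType) (q : nat).
Local Notation col := {ffun V -> 'I_q}.

Definition upd (f : col) u a : col := [ffun x => if x == u then a else f x].

Lemma upd_same f u a : upd f u a u = a.
Proof. by rewrite ffunE eqxx. Qed.

Lemma upd_neq f u a x : x != u -> upd f u a x = f x.
Proof. by rewrite ffunE => /negPf->. Qed.

Lemma updK f u a : upd (upd f u a) u (f u) = f.
Proof. by apply/ffunP=> x; rewrite !ffunE; case: eqP => [->|]. Qed.

(** Swapping the colour at [u] with the spare colour [a] is an involution on pairs [(f, a)]. *)
Lemma sum_recolour u (F : col -> 'I_q -> nat) :
  (\sum_f \sum_a F f a = \sum_f \sum_a F (upd f u a) (f u))%N.
Proof.
rewrite !pair_big /= (reindex_inj (h := fun p => (upd p.1 u p.2, p.1 u))) //.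
apply: (can_inj (g := fun p => (upd p.1 u p.2, p.1 u))) => -[f a] /=.
by rewrite updK upd_same.
Qed.

Lemma card_mem_sum (P : {set col}) : (#|P| = \sum_f (f \in P))%N.
Proof. by rewrite -sum1_card big_mkcond. Qed.

Lemma sum_recolour_card u (P : {set col}) :
  (q * #|P| = \sum_f #|[set a | upd f u a \in P]|)%N.
Proof.
transitivity (\sum_f \sum_(a < q) (f \in P))%N.
  by rewrite card_mem_sum big_distrr /=; apply: eq_bigr => f _; rewrite sum_nat_const card_ord.
rewrite (sum_recolour u); apply: eq_bigr => f _.
by rewrite -sum1dep_card [RHS]big_mkcond /=; apply: eq_bigr => a _; case: ifP.
Qed.

(** Recolouring [u] sends each such [f] to at least [m] members of [P], and different [f] have
    disjoint images, since putting [c] back recovers [f]. *)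
Lemma fibre_card (P : {set col}) u c m :
  (forall f, f \in P -> m <= #|[set a | upd f u a \in P]|)%N ->
  (m * #|[set f in P | f u == c]| <= #|P|)%N.
Proof.
move=> Pm; rewrite !card_mem_sum big_distrr /=.
apply: (@leq_trans (\sum_f \sum_a
    [&& f \in P, f u == c & upd f u a \in P])).
  apply: leq_sum => f _; rewrite inE; case: (boolP (f \in P)) => fP /=; last by rewrite muln0.
  case: eqP => _ /=; last by rewrite muln0.
  rewrite muln1 (leq_trans (Pm f fP)) // -sum1dep_card big_mkcond /=.
  by apply: leq_sum => a _; case: ifP.
rewrite (sum_recolour u); apply: leq_sum => f _.
rewrite (eq_bigr (fun a => if a == c then ((upd f u a \in P) && (f \in P) : nat) else 0%N)).
  by rewrite -big_mkcond big_pred1_eq; case: (upd _ _ _ \in _) => //=.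
move=> a _; rewrite updK upd_same; case: eqP => //=; by rewrite andbF.
Qed.

Variable R : realType.

(** Peels off one vertex at a time. Recolouring [u] leaves the rest of [us] unchanged, so
    [fibre_card] still applies among the colourings avoiding [c] there: unless [c] never occurs at
    [u], a fraction of at most [1 / m u <= x u] has it. *)
Lemma avoid_card (P : {set col}) c (x : V -> R) (m : V -> nat) us : uniq us ->
  (forall u, u \in us -> 0 <= x u <= 1) ->
  (forall u f, u \in us -> f \in P -> m u <= #|[set a | upd f u a \in P]|)%N ->
  (forall u, u \in us -> (forall f, f \in P -> f u != c) \/ 1 <= x u * (m u)%:R) ->
  (\prod_(u <- us) (1 - x u)) * #|P|%:R <=
    #|[set f in P | all (fun u => f u != c) us]|%:R.
Proof.
elim: us => [|u us IH] /=.
  move=> _ _ _ _; rewrite big_nil mul1r ler_nat subset_leq_card //.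
  by apply/subsetP=> f; rewrite !inE andbT.
move=> /andP[uus us_uniq] x01 Pm H.
have us_u w : w \in us -> w \in u :: us by apply: (@mem_behead _ (u :: us)).
have /andP[x0 x1] := x01 u (mem_head _ _).
have {}IH := IH us_uniq (fun w wus => x01 w (us_u w wus))
  (fun w f wus => Pm w f (us_u w wus)) (fun w wus => H w (us_u w wus)).
set Q := [set f in P | all _ us] in IH.
rewrite big_cons -mulrA; apply: le_trans (_ : (1 - x u) * #|Q|%:R <= _).
  by rewrite ler_wpM2l ?subr_ge0.
set Qc := [set f in Q | f u == c].
have -> : [set f in P | (f u != c) && all (fun u => f u != c) us] = Q :\: Qc.
  apply/setP=> f; rewrite !inE.
  by case: (f \in P) => //=; case: (f u == c) => //=; case: all => //=.
have QcQ : Qc \subset Q by apply/subsetP=> f; rewrite inE => /andP[].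
rewrite cardsD (setIidPr QcQ) natrB ?subset_leq_card // mulrBl mul1r lerD2l lerN2.
case: (H u (mem_head _ _)) => {}H.
  suff -> : Qc = set0 by rewrite cards0 mulr_ge0.
  by apply/setP=> f; rewrite !inE; apply/negP=> /andP[/andP[/H/negPf->//]].
have Qm : (m u * #|Qc| <= #|Q|)%N.
  apply: fibre_card => f; rewrite inE => /andP[fP fus].
  apply: leq_trans (Pm u f (mem_head _ _) fP) _; apply: subset_leq_card.
  apply/subsetP=> a; rewrite !inE => ->/=; apply/allP=> w wus.
  rewrite upd_neq ?(allP fus) //; by apply: contraNneq uus => <-.
apply: le_trans (_ : x u * (m u * #|Qc|)%:R <= _); last first.
  by rewrite ler_wpM2l // ler_nat.
by rewrite natrM mulrA ler_peMl.
Qed.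

Lemma expR_le_1B (x : R) : 0 <= x <= 2^-1 -> expR (- (2 * x)) <= 1 - x.
Proof.
move=> /andP[x0 x1].
have h1 : 0 < 1 + 2 * x by lra.
rewrite expRN; apply: le_trans (_ : (1 + 2 * x)^-1 <= _).
  by rewrite lef_pV2 ?posrE ?expR_gt0 ?expR_ge1Dx.
rewrite -(ler_pM2l h1) divff ?gt_eqF //; nra.
Qed.

Lemma jensen_expR (y : 'I_q -> R) (S : R) : (0 < q)%N ->
  - S <= \sum_c y c -> q%:R * expR (- (S / q%:R)) <= \sum_c expR (y c).
Proof.
move=> q0 yS; have q0' : (0 : R) < q%:R by rewrite ltr0n.
set e := expR _.
(* Convexity: the exponential lies above its tangent at [- (S / q)]. *)
apply: le_trans (_ : \sum_(c < q) e * (1 + (y c + S / q%:R)) <= _); last first.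
  apply: ler_sum => c _; rewrite -[y c in leRHS](addrK (S / q%:R)) expRD mulrC.
  by rewrite ler_wpM2r ?expR_ge0 ?expR_ge1Dx.
rewrite -big_distrr /= big_split big_split /= !sumr_const card_ord mulrC.
rewrite ler_wpM2l ?expR_ge0 // -[_ *+ q]mulr_natr -[_ / _ *+ q]mulr_natr mul1r divfK ?gt_eqF //.
lra.
Qed.

(** In a uniform member of [P], colour [c] occurs at [u] with probability at most [x c u], so [A]
    avoids [c] with probability at least [exp(-2 * sum_u x c u)]. For each [u] the [x c u] sum to 2
    over [c], and Jensen's inequality over the colours concludes. Size at least 4 ensures
    [x c u <= 1/2]. *)
Lemma class_sum (P : {set col}) (A : {set V}) (L : V -> {set 'I_q}) (m : V -> nat)
    (D : nat) : (0 < q)%N -> (#|A| <= D)%N ->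
  (forall u f, u \in A -> f \in P -> f u \in L u) ->
  (forall u f, u \in A -> f \in P -> m u <= #|[set a | upd f u a \in P]|)%N ->
  (forall u, u \in A -> 4 <= #|L u| <= 2 * m u)%N ->
  q%:R * expR (- (4 * D%:R / q%:R)) * #|P|%:R <=
    \sum_(f in P) #|[set c | [forall u in A, f u != c]]|%:R :> R.
Proof.
move=> q0 AD PL Pm Lm.
have L4 u : u \in A -> (4 : R) <= #|L u|%:R by move/Lm/andP=> [? _]; rewrite (ler_nat _ 4).
pose x c u : R := if c \in L u then 2 / #|L u|%:R else 0.
have x01 c u : u \in A -> 0 <= x c u <= 2^-1.
  move=> uA; rewrite /x; case: ifP => _; last lra.
  have := L4 u uA; move: (#|L u|%:R) => l l4.
  rewrite divr_ge0 /=; try lra.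
  by rewrite ler_pdivrMr; lra.
have -> : \sum_(f in P) #|[set c | [forall u in A, f u != c]]|%:R =
   \sum_c #|[set f in P | all (fun u => f u != c) (enum A)]|%:R :> R.
  have card_all (f : col) : #|[set c | [forall u in A, f u != c]]|%:R =
      \sum_c (all (fun u => f u != c) (enum A))%:R :> R.
    rewrite -sum1dep_card natr_sum big_mkcond /=; apply: eq_bigr => c _.
    suff -> : all (fun u => f u != c) (enum A) = [forall u in A, f u != c] by case: ifP.
    apply/allP/forall_inP => H u; first by move=> uA; apply: H; rewrite mem_enum.
    by rewrite mem_enum; apply: H.
  rewrite (eq_bigr _ (fun f _ => card_all f)) exchange_big /=; apply: eq_bigr => c _.
  rewrite -sum1dep_card natr_sum [RHS]big_mkcondr /=; apply: eq_bigr => f _.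
  by case: all.
apply: le_trans (_ : \sum_(c < q) expR (- (2 * \sum_(u in A) x c u)) * #|P|%:R <= _).
  rewrite -big_distrl /= ler_wpM2r //; apply: jensen_expR => //.
  rewrite sumrN lerN2 -big_distrr /= exchange_big /=.
  rewrite (eq_bigr (fun _ => 2)) => [|u uA].
    rewrite sumr_const -[_ *+ #|A|]mulr_natr.
    by move: AD; rewrite -(ler_nat R); lra.
  rewrite -big_mkcond /= sumr_const -[_ *+ #|_|]mulr_natr divfK // gt_eqF //.
  by have := L4 u uA; lra.
apply: ler_sum => c _.
have := @avoid_card P c (x c) m (enum A) (enum_uniq _).
move=> H; apply: le_trans (H _ _ _).
- rewrite ler_wpM2r // big_enum /= mulr_sumr -sumrN expR_sum.
  apply: ler_prod => u uA.
  by rewrite expR_ge0 expR_le_1B ?x01.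
- by move=> u; rewrite mem_enum => /(x01 c)/andP[-> ?] /=; lra.
- by move=> u f; rewrite mem_enum; apply: Pm.
move=> u; rewrite mem_enum => uA; rewrite /x; case: ifPn => cL; [right|left].
  have /andP[_] := Lm u uA; rewrite -(ler_nat R) natrM => Lm'.
  rewrite mulrAC ler_pdivlMr ?mul1r //; have := L4 u uA; lra.
by move=> f fP; apply: contraNneq cL => <-; apply: PL.
Qed.
End Recolouring.

(** * Colourings of locally sparse relations *)

Section LocallySparse.
Variables (V : finType) (e : rel V) (q : nat).
Hypotheses (e_sym : symmetric e) (e_irr : irreflexive e).
Local Notation col := {ffun V -> 'I_q}.

Definition nbr v : {set V} := [set u | e v u].

Definition avail (S : {set V}) (f : col) u : {set 'I_q} :=
  [set c | [forall w in S, e u w ==> (f w != c)]].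

(* All functions on [V] that are proper on [S], with arbitrary values elsewhere:
   adding a vertex therefore multiplies the count by (number of extensions) / q. *)
Definition proper (S : {set V}) : {set col} :=
  [set f : col | [forall u in S, forall w in S, e u w ==> (f u != f w)]].

Lemma availP (S : {set V}) (f : col) u c :
  reflect (forall w, w \in S -> e u w -> f w != c) (c \in avail S f u).
Proof. by rewrite inE; apply: (iffP forall_inP) => H w /H /implyP. Qed.

Lemma properP (S : {set V}) (f : col) :
  reflect (forall u w, u \in S -> w \in S -> e u w -> f u != f w) (f \in proper S).
Proof.
rewrite inE; apply: (iffP forall_inP) => H u.
  by move=> w uS wS; apply/implyP; apply: (forall_inP (H u uS)).
by move=> uS; apply/forall_inP=> w wS; apply/implyP/H.
Qed.

Lemma eq_avail (S : {set V}) (f g : col) u : {in S, f =1 g} -> avail S f u = avail S g u.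
Proof.
move=> fg; apply/setP=> c.
by apply/availP/availP=> H w wS euw; [rewrite -fg | rewrite fg] => //; apply: H.
Qed.

Lemma proper_upd (S : {set V}) v (f : col) a : v \notin S ->
  (upd f v a \in proper (v |: S)) = (f \in proper S) && (a \in avail S f v).
Proof.
move=> vS; have Sv w : w \in S -> w != v by apply: contraTneq => ->.
apply/properP/andP=> [H|[/properP Hf /availP Ha] u w].
  split; [apply/properP=> u w uS wS euw | apply/availP=> w wS evw].
    have := H u w (setU1r _ uS) (setU1r _ wS) euw.
    by rewrite !upd_neq ?Sv.
  have := H w v (setU1r _ wS) (setU11 _ _).
  by rewrite e_sym upd_same upd_neq ?Sv //; apply.
rewrite !inE => /orP[/eqP->|uS] /orP[/eqP->|wS].
- by rewrite e_irr.
- by move=> evw; rewrite upd_same upd_neq ?Sv // eq_sym Ha.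
- by move=> euv; rewrite upd_same upd_neq ?Sv // Ha // e_sym.
- by move=> euw; rewrite !upd_neq ?Sv // Hf.
Qed.

Lemma proper_ext_card (S : {set V}) v : v \notin S ->
  (q * #|proper (v |: S)| = \sum_(f in proper S) #|avail S f v|)%N.
Proof.
move=> vS; rewrite (sum_recolour_card v) [RHS]big_mkcond; apply: eq_bigr => f _ /=.
case: (boolP (f \in proper S)) => fS.
  by apply: eq_card => a; rewrite inE proper_upd // fS.
by apply: eq_card0 => a; rewrite inE proper_upd // (negPf fS).
Qed.

Variable R : realType.

(** As [T] omits [u], having few available colours does not depend on the colour of [u]. Once
    [S :\ u] is coloured, [u] then has fewer than [s] choices, because the colours allowed by
    [S :\ u] are among those allowed by [T]. *)
Lemma few_avail_card (S T : {set V}) u (s : R) : 0 <= s -> u \in S -> T \subset S :\ u ->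
  q%:R * #|[set f in proper S | #|avail T f u|%:R < s]|%:R
    <= s * #|proper (S :\ u)|%:R.
Proof.
move=> s0 uS TS; rewrite -natrM (sum_recolour_card u) natr_sum.
have uS' : u \notin S :\ u by rewrite !inE eqxx.
rewrite card_mem_sum natr_sum mulr_sumr; apply: ler_sum => f _.
set B := [set a | _].
have BP a : a \in B ->
    [/\ f \in proper (S :\ u), a \in avail (S :\ u) f u & #|avail T f u|%:R < s].
  rewrite [a \in B]inE [upd f u a \in _]inE -[X in proper X](setD1K uS) proper_upd //.
  move=> /andP[/andP[-> ->]]; rewrite (@eq_avail T (upd f u a) f) // => w /(subsetP TS).
  by rewrite !inE => /andP[wu _]; rewrite upd_neq.
have [->|[a0 /BP[-> _ fs]]] := set_0Vmem B; first by rewrite cards0 mulr_ge0.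
rewrite mulr1; apply: le_trans (ltW fs); rewrite ler_nat subset_leq_card //.
apply/subsetP=> a /BP[_ /availP aS _]; apply/availP=> w wT.
by apply: aS; apply: (subsetP TS).
Qed.

Section Neighbourhood.
Variables (S : {set V}) (v : V) (c0 : 'I_q) (s : R) (D h m : nat).
Hypothesis vS : v \notin S.

Let T := S :\: nbr v.
(* A neighbour is good when it has at most [h] common neighbours with [v] and at
   least [s] colours available once the colours on all of [nbr v] are ignored;
   the good set thus depends only on the colours outside [nbr v]. *)
Definition crowded : {set V} := [set u in nbr v | (h < #|nbr u :&: nbr v|)%N].
Definition good (f : col) : {set V} :=
  [set u in (S :&: nbr v) :\: crowded | s <= #|avail T f u|%:R].
Definition erase (f : col) : col := [ffun x => if x \in good f then c0 else f x].

Lemma good_sub f : good f \subset S :&: nbr v.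
Proof. by apply/subsetP=> u; rewrite inE => /andP[/setDP[]]. Qed.

Lemma eq_good (f g : col) : {in T, f =1 g} -> good f = good g.
Proof. by move=> fg; apply/setP=> u; rewrite !inE (@eq_avail T f g). Qed.

Lemma good_notinT f u : u \in good f -> u \notin T.
Proof. by move=> /(subsetP (good_sub f)); rewrite !inE => /andP[-> ->]. Qed.

Lemma erase_inT f : {in T, erase f =1 f}.
Proof. by move=> u uT; rewrite ffunE; case: ifP => // /good_notinT; rewrite uT. Qed.

Lemma upd_inT (f : col) u a : u \notin T -> {in T, upd f u a =1 f}.
Proof. by move=> uT w wT; rewrite upd_neq //; apply: contraNneq uT => <-. Qed.

Lemma erase_upd (f : col) u a : u \in good f -> erase (upd f u a) = erase f.
Proof.
move=> uf; have uT := good_notinT uf.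
apply/ffunP=> x; rewrite !ffunE (eq_good (@upd_inT f u a uT)).
by case: eqP => [->|//]; rewrite uf.
Qed.

Hypotheses (nbr_D : forall u, (#|nbr u| <= D)%N) (s4 : 4 <= s) (sh : 2 * h%:R <= s).

Lemma good_D f : (#|good f| <= D)%N.
Proof.
apply: leq_trans (subset_leq_card (good_sub f)) _.
by apply: leq_trans (subset_leq_card (subsetIr _ _)) _.
Qed.

(* Colourings are grouped by their restriction to the complement of their good
   neighbourhood: inside a group the good vertices have fixed lists, of which
   the colours of their at most [h] common neighbours with [v] may be missing. *)
Lemma good_avoid_sum :
  q%:R * expR (- (4 * D%:R / q%:R)) * #|proper S|%:R <=
    \sum_(f in proper S) #|[set c | [forall u in good f, f u != c]]|%:R :> R.
Proof.
have q0 : (0 < q)%N by apply: leq_ltn_trans (ltn_ord c0).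
have -> : #|proper S| = (\sum_g #|[set f in proper S | erase f == g]|)%N.
  rewrite -sum1_card (partition_big erase predT) //=; apply: eq_bigr => g _.
  by rewrite -sum1_card; apply: eq_bigl => f; rewrite inE.
rewrite natr_sum mulr_sumr [leRHS](partition_big erase predT) //=; apply: ler_sum => g _.
set P := [set f in _ | _].
have PT f : f \in P -> {in T, f =1 g}.
  by rewrite inE => /andP[_ /eqP<-] u /erase_inT.
have Pgood f : f \in P -> good f = good g by move/PT/eq_good.
have -> : \sum_(f in proper S | erase f == g) #|[set c | [forall u in good f, f u != c]]|%:R =
  \sum_(f in P) #|[set c | [forall u in good g, f u != c]]|%:R :> R.
  apply: eq_big => f; first by rewrite !inE.
  by move=> /andP[fS fg]; rewrite (Pgood f) // inE fS.
apply: (@class_sum V q R P (good g) (avail T g) (fun u => #|avail T g u| - h)%N) => //.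
- exact: good_D.
- move=> u f ug fP; rewrite -(eq_avail _ (PT f fP)); apply/availP=> w wT euw.
  move: fP wT; rewrite inE => /andP[/properP fS _]; rewrite inE => /andP[_ wS].
  by rewrite eq_sym fS //; have /(subsetP (good_sub g)) := ug; rewrite inE => /andP[].
- move=> u f ug fP; rewrite -(eq_avail _ (PT f fP)).
  have uf : u \in good f by rewrite Pgood.
  have /setIP[uS uv] := subsetP (good_sub g) u ug.
  have uh : (#|nbr u :&: nbr v| <= h)%N.
    move: ug; rewrite inE => /andP[/setDP[_ uc] _].
    by rewrite leqNgt; apply: contra uc => hu; rewrite inE uv.
  apply: (@leq_trans #|avail T f u :\: f @: (nbr u :&: nbr v)|).
    rewrite cardsD leq_sub2l // (leq_trans (subset_leq_card (subsetIr _ _))) //.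
    exact: leq_trans (leq_imset_card _ _) uh.
  apply: subset_leq_card; apply/subsetP=> a /setDP[/availP aT aim].
  move: fP; rewrite inE => /andP[/properP fS ferase].
  rewrite inE [_ \in P]inE erase_upd // ferase andbT.
  have uS' : u \notin S :\ u by rewrite !inE eqxx.
  have := proper_upd f a uS'; rewrite setD1K // => ->.
  apply/andP; split.
    by apply/properP=> x y /setD1P[_ xS] /setD1P[_ yS]; apply: fS.
  apply/availP=> w /setD1P[_ wS] euw.
  case: (boolP (w \in nbr v)) => wv; last by apply: aT; rewrite // inE wv.
  by apply: contraNneq aim => <-; apply: imset_f; rewrite inE wv inE euw.
move=> u; rewrite inE => /andP[_ su].
have l4 : (4 <= #|avail T g u|)%N by rewrite -(ler_nat R) (le_trans s4).
rewrite l4 /=; have : (2 * h <= #|avail T g u|)%N by rewrite -(ler_nat R) natrM (le_trans sh).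
by move: #|_| => l; rewrite mulnBr; lia.
Qed.

Lemma avail_ge (f : col) :
  (#|[set c | [forall u in good f, f u != c]]| <= #|avail S f v| + #|crowded| +
    \sum_(u in S :&: nbr v) (#|avail T f u|%:R < s)%R)%N.
Proof.
set N := S :&: nbr v.
have le1 : (#|N :\: good f| <= #|crowded| + \sum_(u in N) (#|avail T f u|%:R < s)%R)%N.
  apply: (@leq_trans #|crowded :|: [set u in N | (#|avail T f u|%:R < s)%R]|).
    apply: subset_leq_card; apply/subsetP=> u /setDP[uN].
    rewrite [u \in good f]inE in_setD uN andbT negb_and negbK -ltNge in_setU.
    by case/orP=> [->//|us]; rewrite [u \in [set _ in _ | _]]inE uN us orbT.
  rewrite (leq_trans (leq_card_setU _ _)) // leq_add2l -sum1dep_card big_mkcondr /=.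
  by apply: leq_sum => u _; case: ifP.
rewrite -addnA; apply: leq_trans (leq_add (leqnn _) le1).
apply: (@leq_trans #|avail S f v :|: f @: (N :\: good f)|); last first.
  by rewrite (leq_trans (leq_card_setU _ _)) // leq_add2l leq_imset_card.
apply: subset_leq_card; apply/subsetP=> c; rewrite inE => /forall_inP cgood.
rewrite inE; case: (boolP (c \in f @: _)) => [|cN]; rewrite ?orbT ?orbF //.
apply/availP=> w wS evw; apply: contraNneq cN => fw; rewrite -fw imset_f // in_setD.
apply/andP; split; last by rewrite !inE wS.
by apply/negP=> /cgood; rewrite fw eqxx.
Qed.

Hypothesis crowded_m : (#|crowded| <= m)%N.
Variable l : R.
Hypotheses (l0 : 0 < l)
  (qD : l + m%:R + D%:R * (s / l) <= q%:R * expR (- (4 * D%:R / q%:R)))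
  (IH : forall u, u \in S -> l * #|proper (S :\ u)|%:R <= q%:R * #|proper S|%:R).

(** Averages [avail_ge] over [proper S]. Crowded vertices cost at most [m] colours, and those with
    few available colours at most [D * (s / l)] on average, as [few_avail_card] and [IH] bound the
    probability of each by [s / l]. By [qD] an average of at least [l] colours remains. *)
Lemma proper_ext : l * #|proper S|%:R <= q%:R * #|proper (v |: S)|%:R.
Proof.
have q0 : (0 : R) < q%:R by rewrite ltr0n; apply: leq_ltn_trans (ltn_ord c0).
have s0 : 0 <= s by apply: le_trans s4.
set P := proper S; set N := S :&: nbr v.
rewrite -natrM proper_ext_card // natr_sum.
have bad u : u \in N -> #|[set f in P | #|avail T f u|%:R < s]|%:R <= s / l * #|P|%:R :> R.
  move=> /setIP[uS uv].
  have TS : T \subset S :\ u.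
    apply/subsetP=> w; rewrite !inE => /andP[wv ->]; rewrite andbT.
    by apply: contraNneq wv => ->; move: uv; rewrite inE.
  have := few_avail_card s0 uS TS; have := IH uS; rewrite -/P.
  move=> H1 H2; rewrite mulrAC ler_pdivlMr // -(ler_pM2l q0).
  apply: le_trans (_ : l * (s * #|proper (S :\ u)|%:R) <= _).
    by rewrite [leLHS]mulrA [leLHS]mulrC; apply: ler_wpM2l H2; apply: ltW.
  by rewrite mulrCA [leRHS]mulrCA ler_wpM2l.
have sumN : \sum_(f in P) \sum_(u in N) (#|avail T f u|%:R < s)%R%:R <=
    D%:R * (s / l) * #|P|%:R :> R.
  rewrite exchange_big /=.
  apply: le_trans (_ : \sum_(u in N) s / l * #|P|%:R <= _).
    apply: ler_sum => u uN; apply: le_trans (bad u uN).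
    rewrite -sum1dep_card natr_sum big_mkcondr /=.
    by apply: ler_sum => f _; case: ifP.
  rewrite sumr_const -[_ *+ #|_|]mulr_natl -[leRHS]mulrA.
  rewrite ler_wpM2r ?mulr_ge0 ?invr_ge0 ?(ltW l0) //.
  rewrite ler_nat; apply: leq_trans (nbr_D v); exact: subset_leq_card (subsetIr _ _).
have := good_avoid_sum; rewrite -/P => H.
have {}H : q%:R * expR (- (4 * D%:R / q%:R)) * #|P|%:R <=
    \sum_(f in P) #|avail S f v|%:R + m%:R * #|P|%:R + D%:R * (s / l) * #|P|%:R.
  apply: le_trans H _; apply: le_trans (lerD (lexx _) sumN).
  have -> : m%:R * #|P|%:R = \sum_(f in P) m%:R :> R by rewrite sumr_const -[RHS]mulr_natr.
  rewrite -!big_split /=; apply: ler_sum => f _.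
  rewrite -natr_sum -!natrD ler_nat; apply: leq_trans (avail_ge f) _.
  by rewrite leq_add2r leq_add2l.
have := ler_wpM2r (ler0n R #|P|) qD; rewrite mulrDl (mulrDl l) => H1.
by have := le_trans H1 H; rewrite 2!lerD2r.
Qed.
End Neighbourhood.

Theorem colouring_of_sparse_nbrs (s l : R) (D h m : nat) :
  (0 < q)%N -> 0 < l -> 4 <= s -> 2 * h%:R <= s ->
  (forall v, #|nbr v| <= D)%N -> (forall v, #|crowded v h| <= m)%N ->
  l + m%:R + D%:R * (s / l) <= q%:R * expR (- (4 * D%:R / q%:R)) ->
  exists f : col, forall u w, e u w -> f u != f w.
Proof.
move=> q0 l0 s4 sh nbrD crm qD.
(* Induction on a bound for the size of [S]: the hypothesis [IH] of [proper_ext] is the claim for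
   [S :\ u] and the vertex [u]. *)
have ext n (S : {set V}) v : (#|S| <= n)%N -> v \notin S ->
    l * #|proper S|%:R <= q%:R * #|proper (v |: S)|%:R.
  elim: n S v => [|n IH] S v Sn vS;
    apply: (@proper_ext S v (Ordinal q0) s D h m) => // u uS.
    by move: Sn; rewrite leqNgt card_gt0; case/negP; apply/set0Pn; exists u.
  rewrite -[in leRHS](setD1K uS); apply: IH; last by rewrite !inE eqxx.
  by move: Sn; rewrite (cardsD1 u) uS.
have pos n (S : {set V}) : (#|S| <= n)%N -> (0 < #|proper S|)%N.
  elim: n S => [|n IH] S Sn.
    rewrite card_gt0; apply/set0Pn; exists [ffun=> Ordinal q0].
    apply/properP=> u w uS; move: Sn; rewrite leqNgt card_gt0; case/negP.
    by apply/set0Pn; exists u.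
  have [S0|[v vS]] := set_0Vmem S; first by apply: IH; rewrite S0 cards0.
  have vS' : v \notin S :\ v by rewrite !inE eqxx.
  have Sn' : (#|S :\ v| <= n)%N by move: Sn; rewrite (cardsD1 v) vS.
  have := ext _ _ _ (leqnn _) vS'; rewrite setD1K // => H.
  rewrite -(ltr0n R) -(pmulr_rgt0 _ (_ : 0 < q%:R)) ?ltr0n //.
  by apply: lt_le_trans H; rewrite mulr_gt0 // ltr0n IH.
have := pos _ [set: V] (leqnn _); rewrite card_gt0 => /set0Pn[f /properP Hf].
by exists f => u w; apply: Hf.
Qed.
End LocallySparse.

(** * Balls in graphs of large girth *)

Section Balls.
Local Open Scope nat_scope.

Lemma leq_card_bigcup (T U : finType) (A : {set T}) (F : T -> {set U}) b :
  (forall x, x \in A -> #|F x| <= b) -> #|\bigcup_(x in A) F x| <= #|A| * b.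
Proof.
move=> Fb; rewrite -sum_nat_const.
apply: (@leq_trans (\sum_(x in A) #|F x|)); last exact: leq_sum.
apply: (big_ind2 (fun (B : {set U}) n => #|B| <= n)); first by rewrite cards0.
  move=> B1 n1 B2 n2 le1 le2; rewrite (leq_trans (leq_card_setU _ _)) //.
  exact: leq_add.
by [].
Qed.

Variable G : sgraph.
Local Notation nb := (nbr (@adj G)).

Fixpoint ball (u : G) k : {set G} :=
  if k is k'.+1 then \bigcup_(x in ball u k') (x |: nb x) else [set u].

Lemma ballSP u k z :
  reflect (exists2 x, x \in ball u k & z = x \/ adj x z) (z \in ball u k.+1).
Proof.
apply: (iffP bigcupP) => -[x xb H]; exists x => //.
  by move: H; rewrite !inE => /orP[/eqP->|]; [left|right].
by rewrite !inE; case: H => [->|->]; rewrite ?eqxx ?orbT.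
Qed.

Lemma ball_leq u i j : i <= j -> ball u i \subset ball u j.
Proof.
move=> /subnKC <-; elim: (j - i) => [|n IH]; rewrite ?addn0 // addnS.
apply: subset_trans IH _; apply/subsetP=> x xb.
by apply/ballSP; exists x => //; left.
Qed.

(** [p] omits its starting point [z], so only [z] may lie on the outer layer; this keeps the walks
    of [ball_nbr_uniq] away from [w]. *)
Lemma ball_path u k z : z \in ball u k -> exists p,
  [/\ path (@adj G) z p, last z p = u, size p <= k & {subset p <= ball u k.-1}].
Proof.
elim: k z => [|k IH] z; first by rewrite inE => /eqP->; exists [::].
case/ballSP=> x xb xz; have [p [px pl ps pb]] := IH x xb.
have {}pb : {subset p <= ball u k}.
  by move=> y /pb; apply: subsetP; apply: ball_leq; apply: leq_pred.
case: xz => [->|xz]; first by exists p; split=> //; apply: leq_trans ps _.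
exists (x :: p); split=> //=; first by rewrite adj_sym xz.
by move=> y; rewrite inE => /orP[/eqP->//|/pb].
Qed.

Lemma path_ball x p : path (@adj G) x p -> last x p \in ball x (size p).
Proof.
elim/last_ind: p => [|p y IH] /=; first by rewrite inE.
rewrite rcons_path last_rcons size_rcons => /andP[/IH pb py].
by apply/ballSP; exists (last x p) => //; right.
Qed.

Lemma ball_sym u k z : z \in ball u k -> u \in ball z k.
Proof.
move=> /ball_path[p [pz <- ps _]].
by apply: (subsetP (ball_leq _ ps)); apply: path_ball.
Qed.

Variables (t Delta : nat).
Hypotheses (girth_t : leo (Some (2 * t + 1)) (girth G))
  (deg_Delta : max_degree G <= Delta).
Local Notation d := Delta.+1.

(* Paths from [z] and [z'] to [u] whose vertices other than [z], [z'] lie in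
   [ball u k] avoid [w], so together with [w] they yield a cycle of length at
   most [2 * (k + 2)]. *)
Lemma ball_nbr_uniq u k w z z' : k.+2 <= t -> w \notin ball u k ->
  adj w z -> adj w z' -> z \in ball u k.+1 -> z' \in ball u k.+1 -> z = z'.
Proof.
move=> kt wb wz wz' /ball_path[p [pz pl ps pb]] /ball_path[p' [pz' pl' ps' pb']].
apply/eqP/negPn/negP=> zz'.
set r := p ++ rev (belast z' p').
have wnotin y q : adj w y -> {subset q <= ball u k} -> w \notin y :: q.
  move=> wy qb; rewrite inE negb_or; apply/andP; split.
    by apply: contraTneq wy => <-; rewrite adj_irrefl.
  by apply: contra wb => /qb.
have r_path : path (@adj G) z r.
  rewrite cat_path pz pl -pl' rev_path /=.
  by rewrite (eq_path (e' := @adj G)) // => x y; rewrite adj_sym.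
have r_last : last z r = z'.
  rewrite last_cat pl -pl'; case: (p') => //= y s; by rewrite rev_cons last_rcons.
have wr : w \notin z :: r.
  rewrite -cat_cons mem_cat mem_rev negb_or wnotin //=.
  by apply: contra (wnotin _ _ wz' pb') => /mem_belast.
move: r_last; case/shortenP: r_path => r' r'_path r'_uniq r'r r'_last.
(* [z != z'] gives the cycle at least three vertices; its length is at most [2 * k.+1 + 2 <= 2 * t],
   below the girth. *)
have r'0 : 0 < size r'.
  by case: r' r'_last {r'_path r'_uniq r'r} => //= zE; rewrite zE eqxx in zz'.
have size_r' : size r' <= 2 * k.+1.
  have := uniq_leq_size (proj2 (andP r'_uniq)) r'r.
  rewrite /r size_cat size_rev size_belast => /leq_trans-> //.
  by rewrite mul2n -addnn leq_add.
have cyc : ucycle (@adj G) [:: w, z & r'].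
  apply/andP; split.
    by rewrite /= rcons_path wz r'_path r'_last adj_sym.
  rewrite cons_uniq r'_uniq andbT; apply: contra wr.
  by rewrite !inE => /orP[->//|/r'r->]; rewrite orbT.
have /(_ r'0) := girth_geP _ _ girth_t _ _ cyc.
rewrite leqNgt addn1 ltnS /= => /negP; apply.
by apply: (@leq_trans (2 * k.+1).+2); [rewrite !ltnS | lia].
Qed.

Lemma card_nb x : #|nb x| <= Delta.
Proof. by apply: leq_trans deg_Delta; rewrite /max_degree (bigD1 x) //= leq_maxl. Qed.

Lemma card_ball u k : #|ball u k| <= d ^ k.
Proof.
elim: k => [|k IH]; first by rewrite cards1.
rewrite expnSr (leq_trans (leq_card_bigcup (b := d) _)) ?leq_mul2r ?IH ?orbT //.
move=> x _; rewrite (leq_trans (leq_card_setU _ _)) // cards1 add1n ltnS.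
exact: card_nb.
Qed.

(** A vertex of the next intersection equals or is adjacent to some [w] in [ball y k]. If [w] is in
    [ball u k], it contributes at most [d] vertices; otherwise [ball_nbr_uniq] leaves only [w] and
    one neighbour. Hence the recurrence [a' <= d * a + 2 * d ^ k]. *)
Lemma card_ballI u y k : u != y -> k < t ->
  d * #|ball y k :&: ball u k| <= 2 * k * d ^ k.
Proof.
move=> uy; elim: k => [|k IH] kt.
  rewrite (_ : _ :&: _ = set0) ?cards0 ?muln0 //.
  apply/setP=> x; rewrite !inE; apply/negP=> /andP[/eqP-> /eqP E].
  by rewrite E eqxx in uy.
set I := ball y k :&: ball u k in IH *.
have sub : ball y k.+1 :&: ball u k.+1 \subset
   (\bigcup_(w in I) (w |: nb w)) :|:
   \bigcup_(w in ball y k :\: ball u k) (w |: (nb w :&: ball u k.+1)).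
  apply/subsetP=> z /setIP[/bigcupP[w wy zw] zu]; rewrite inE.
  case: (boolP (w \in ball u k)) => wu.
    by apply/orP; left; apply/bigcupP; exists w; rewrite // inE wy.
  apply/orP; right; apply/bigcupP; exists w; first by rewrite inE wu.
  by move: zw; rewrite !in_setU1 in_setI zu andbT.
have le1 : #|\bigcup_(w in I) (w |: nb w)| <= #|I| * d.
  apply: leq_card_bigcup => x _; rewrite (leq_trans (leq_card_setU _ _)) //.
  by rewrite cards1 add1n ltnS card_nb.
have le2 : #|\bigcup_(w in ball y k :\: ball u k) (w |: (nb w :&: ball u k.+1))|
    <= d ^ k * 2.
  apply: (@leq_trans (#|ball y k :\: ball u k| * 2)).
    apply: leq_card_bigcup => w /setDP[_ wu].
    rewrite (leq_trans (leq_card_setU _ _)) // cards1 add1n ltnS.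
    apply/card_le1P => z /setIP[wz zu] z'; rewrite [RHS]inE.
    apply/idP/eqP => [/setIP[wz' zu']|->]; last by rewrite inE wz.
    rewrite !inE in wz wz'; exact: ball_nbr_uniq kt wu wz' wz zu' zu.
  by rewrite leq_mul2r /= (leq_trans _ (card_ball y k)) // subset_leq_card ?subsetDl.
have {}IH := IH (ltnW kt).
have := subset_leq_card sub; move=> /leq_trans/(_ (leq_card_setU _ _)) le3.
have := leq_trans le3 (leq_add le1 le2); move: IH; rewrite expnS.
move: #|_| #|I| (d ^ k) => a b c H1 H2; nia.
Qed.

(** * Edges within bounded distance of one another *)

Definition touch (A : {set G}) : {set edge G} :=
  \bigcup_(x in A) [set g : edge G | x \in val g].

Lemma touchP (A : {set G}) (g : edge G) :
  reflect (exists2 x, x \in A & x \in val g) (g \in touch A).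
Proof. by apply: (iffP bigcupP) => -[x xA]; [rewrite inE|]; exists x; rewrite ?inE. Qed.

Lemma edgeP (g : edge G) x : x \in val g -> exists2 y, adj x y & val g = [set x; y].
Proof.
case: g => g /= gE; have := gE; rewrite inE => /existsP[a /existsP[b /andP[ab /eqP->]]].
rewrite !inE => /orP[]/eqP->; first by exists b.
by exists a; rewrite 1?adj_sym // setUC.
Qed.

Lemma card_edge (g : edge G) : #|val g| <= 2.
Proof.
case: g => g /= gE; have := gE; rewrite inE => /existsP[a /existsP[b /andP[ab /eqP->]]].
by rewrite cards2; case: (_ != _).
Qed.

Lemma card_touch (A : {set G}) : #|touch A| <= #|A| * Delta.
Proof.
apply: leq_card_bigcup => x _; rewrite -(card_imset _ val_inj).
apply: leq_trans (card_nb x); apply: leq_trans (leq_imset_card (fun y => [set x; y]) _).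
apply: subset_leq_card; apply/subsetP=> _ /imsetP[g + ->].
by rewrite inE => /edgeP[y xy ->]; apply: imset_f; rewrite inE.
Qed.

(** Such an edge either contains a vertex common to both balls, counted by [card_ballI], or joins
    some [z] of [ball y k] outside [ball u k] to [ball u k]; the girth leaves at most one such edge
    per [z]. *)
Lemma card_touchI u y k : u != y -> k.+1 = t -> 0 < k ->
  #|touch (ball y k) :&: touch (ball u k)| <= 2 * t * d ^ k.
Proof.
move=> uy kt k0; set Y := ball y k; set U := ball u k.
have sub : touch Y :&: touch U \subset touch (Y :&: U) :|:
    \bigcup_(z in Y :\: U) ([set g : edge G | z \in val g] :&: touch U).
  apply/subsetP=> g /setIP[/touchP[z zY zg] gU]; rewrite inE.
  case: (boolP (z \in U)) => zU; apply/orP; [left|right].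
    by apply/touchP; exists z; rewrite // inE zY.
  by apply/bigcupP; exists z; rewrite !inE ?zU ?zg.
have le1 : #|touch (Y :&: U)| <= d * #|Y :&: U|.
  by rewrite mulnC (leq_trans (card_touch _)) // leq_mul2l leqnSn orbT.
have le2 : #|\bigcup_(z in Y :\: U) ([set g : edge G | z \in val g] :&: touch U)| <= d ^ k.
  apply: (@leq_trans (#|Y :\: U| * 1)); last first.
    by rewrite muln1 (leq_trans _ (card_ball y k)) // subset_leq_card ?subsetDl.
  apply: leq_card_bigcup => z /setDP[_ zU].
  have other (g : edge G) : g \in [set g : edge G | z \in val g] :&: touch U ->
      exists x, [/\ adj z x, x \in U & val g = [set z; x]].
    move=> /setIP[]; rewrite inE => /edgeP[x zx gE] /touchP[x' x'U].
    rewrite gE !inE => /orP[]/eqP x'E; first by rewrite -x'E x'U in zU.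
    by exists x; rewrite -x'E in gE zx *.
  apply/card_le1P => g gU g'; rewrite [RHS]inE.
  apply/idP/eqP => [g'U|->//].
  have [x [zx xU gE]] := other g gU; have [x' [zx' x'U g'E]] := other g' g'U.
  apply: val_inj; rewrite gE g'E; congr [set _; _].
  (* [ball_nbr_uniq] requires [k.+2 <= t], which fails here, so it is applied at radius [k.-1]. *)
  rewrite /U -(prednK k0) in zU xU x'U.
  apply: (ball_nbr_uniq (w := z) _ _ zx' zx x'U xU); first by rewrite prednK // kt.
  by apply: contra zU; apply: subsetP; apply: ball_leq.
have le3 : d * #|Y :&: U| <= 2 * k * d ^ k by apply: card_ballI; rewrite // -kt.
have := subset_leq_card sub; move=> /leq_trans/(_ (leq_card_setU _ _)) le4.
have := leq_trans le4 (leq_add le1 le2); rewrite -kt.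
move: le3; move: (d * #|Y :&: U|) (d ^ k) #|touch Y :&: touch U| => a b c H1 H2; nia.
Qed.

(** With [k.+1 = t] this is distance at most [t]: a path on at most [t] vertices has at most [k]
    steps. *)
Definition near k : rel (edge G) := fun g f =>
  (g != f) && [exists x in val g, f \in touch (ball x k)].

Lemma near_sym k : symmetric (near k).
Proof.
suff sub g f : near k g f -> near k f g by move=> g f; apply/idP/idP; apply: sub.
rewrite /near eq_sym => /andP[->/=] /exists_inP[x xg /touchP[y yx yf]].
by apply/exists_inP; exists y => //; apply/touchP; exists x => //; apply: ball_sym.
Qed.

Lemma near_irr k : irreflexive (near k).
Proof. by move=> g; rewrite /near eqxx. Qed.

Lemma near_touch k (g : edge G) :
  nbr (near k) g \subset \bigcup_(x in val g) touch (ball x k).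
Proof.
apply/subsetP=> f; rewrite inE => /andP[_ /exists_inP[x xg fx]].
by apply/bigcupP; exists x.
Qed.

Lemma card_near k g : k.+1 = t -> #|nbr (near k) g| <= 2 * d ^ t.
Proof.
move=> kt; apply: leq_trans (subset_leq_card (near_touch k g)) _.
apply: (@leq_trans (#|val g| * d ^ t)); last by rewrite leq_mul2r card_edge orbT.
apply: leq_card_bigcup => x _; rewrite (leq_trans (card_touch _)) // -kt expnSr.
by rewrite leq_mul // card_ball.
Qed.

(** If [f] and [g] are disjoint, each of the at most four pairs of ends accounts for at most
    [2 * t * d ^ k] common neighbours by [card_touchI]. So crowded edges share an end with [g]. *)
Lemma card_crowded k g : k.+1 = t -> 0 < k ->
  #|crowded (near k) g (8 * t * d ^ k)| <= 2 * d.
Proof.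
move=> kt k0; apply: (@leq_trans (#|val g| * Delta)); last first.
  by rewrite leq_mul ?card_edge.
apply: leq_trans (card_touch (val g)); apply: subset_leq_card; apply/subsetP=> f.
rewrite inE => /andP[_]; apply: contraTT => fg; rewrite -leqNgt.
have sub : nbr (near k) f :&: nbr (near k) g \subset
    \bigcup_(y in val f) \bigcup_(x in val g) (touch (ball y k) :&: touch (ball x k)).
  apply/subsetP=> e /setIP[/(subsetP (near_touch k f))/bigcupP[y yf ey]].
  move=> /(subsetP (near_touch k g))/bigcupP[x xg ex].
  by apply/bigcupP; exists y => //; apply/bigcupP; exists x; rewrite // inE ey.
apply: leq_trans (subset_leq_card sub) _.
apply: (@leq_trans (#|val f| * (2 * (2 * t * d ^ k)))); last first.
  by have := card_edge f; move: #|_| (d ^ k) => a b; nia.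
apply: leq_card_bigcup => y yf.
apply: (@leq_trans (#|val g| * (2 * t * d ^ k))); last by rewrite leq_mul2r card_edge orbT.
apply: leq_card_bigcup => x xg; apply: card_touchI => //.
by apply: contraNneq fg => xy; apply/touchP; exists x; rewrite // xy.
Qed.

Lemma dist_chromatic_index_near k q (c : {ffun edge G -> 'I_q}) : k.+1 = t ->
  (forall g f, near k g f -> c g != c f) -> dist_chromatic_index G t <= q.
Proof.
move=> kt cnear; rewrite /dist_chromatic_index; case: ex_minnP => n _; apply.
apply/existsP; exists c; apply/forallP=> g; apply/forallP=> f; apply/implyP.
move=> /andP[gf /edge_dist_leP[[//|x p] xpt /and4P[xg pf xp _]]].
apply: cnear; rewrite /near gf; apply/exists_inP; exists x => //.
apply/touchP; exists (last x p) => //; apply: subsetP (path_ball xp).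
by apply: ball_leq; rewrite -ltnS kt.
Qed.
End Balls.

(** * The bound on the distance-t chromatic index *)

Theorem theorem2 (R : realType) (t : nat) (ht : (2 <= t)%N) :
  exists (C : R) (Delta0 : nat),
    [/\ 0 < C, (2 <= Delta0)%N &
        forall (Delta : nat) (G : sgraph),
          (Delta0 <= Delta)%N ->
          leo (Some (2 * t + 1)%N) (girth G) ->
          (max_degree G <= Delta)%N ->
          (dist_chromatic_index G t)%:R
            <= C * (Delta%:R ^+ t / ln (Delta%:R : R))].
Proof.
case: t ht => // k k0.
set t := k.+1; rewrite ltnS in k0.
pose K : R := 2 ^+ t.
have K1 : 1 <= K by apply: exprn_ege1; lra.
(* [K] absorbs [(Delta + 1) ^ t <= 2 ^ t * Delta ^ t]. The factor 128 makes
   [4 * D / q <= ln Delta / 8] for [D = 2 * (Delta + 1) ^ t], even after rounding [q] down; the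
   threshold makes [Delta ^ (1/8) >= 16 * t * K]. *)
exists (128 * K), ((16 * t * 2 ^ t) ^ 8)%N; split; first lra.
  have : (1 <= 2 ^ t)%N by rewrite expn_gt0.
  move: (2 ^ t)%N => a a1; apply: (@leq_trans (16 * t * a)%N); first by rewrite /t; nia.
  by rewrite -[leqLHS]expn1 leq_pexp2l // /t; nia.
move=> Delta G Delta_ge girth_t deg_Delta.
set Dl : R := Delta%:R.
have t1 : (1 : R) <= t%:R by rewrite (ler_nat _ 1).
have Dl_ge : (16 * t%:R * K) ^+ 8 <= Dl.
  by rewrite /K -natrX -!natrM -natrX ler_nat.
have tK1 : 16 <= 16 * t%:R * K by nra.
have Dl2 : 2 <= Dl.
  apply: le_trans Dl_ge; apply: (@le_trans _ _ (16 * t%:R * K)); first lra.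
  by rewrite -[leLHS]expr1 ler_weXn2l //; lra.
(* X = Delta^(1/8) *)
pose L := ln Dl / 8; pose X := expR L.
have X8 : X ^+ 8 = Dl.
  rewrite /X -expRM_natl (_ : _ * L = ln Dl) ?lnK ?posrE //; first lra.
  by rewrite /L; field.
have X_ge : 16 * t%:R * K <= X.
  rewrite -(@ler_pXn2r _ 8) ?nnegrE ?expR_ge0 ?X8 //; lra.
have L0 : 0 < L by rewrite /L divr_gt0 // ln_gt0 //; lra.
have LX : L <= X by have := expR_ge1Dx L; rewrite -/X; lra.
have X0 : 0 < X by lra.
pose P := Dl ^+ t.
have P0 : 0 < P by apply: exprn_gt0; lra.
have dP j : (Delta.+1%:R : R) ^+ j <= 2 ^+ j * Dl ^+ j.
  rewrite -exprMn lerXn2r ?nnegrE ?ler0n //; first lra.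
  by rewrite -natr1 -/Dl; lra.
have X_pow j : (0 < j)%N -> X <= X ^+ j.
  by move=> j0; rewrite -[leLHS]expr1 ler_weXn2l //; lra.
have Dk : Dl <= Dl ^+ k by rewrite -[leLHS]expr1 ler_weXn2l //; lra.
have PX2 : 4 * Dl <= P / X ^+ 2.
  have -> : P / X ^+ 2 = Dl ^+ k * X ^+ 6.
    by rewrite /P /t exprS -X8; field; rewrite gt_eqF.
  have := X_pow 6 isT; move: (X ^+ 6) => X6 HX6; rewrite mulrC ler_pM //; lra.
set y := 128 * K * _.
have yE : y = 16 * K * P / L.
  rewrite /y /L -/P; field; rewrite gt_eqF //.
  by rewrite ln_gt0 //; lra.
have y_ge : 16 * K * P / X <= y.
  rewrite yE ler_wpM2l ?lef_pV2 ?posrE //; nra.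
have y2 : 2 <= y.
  apply: le_trans y_ge; rewrite ler_pdivlMr //.
  have PX : X <= P.
    apply: (@le_trans _ _ (P / X ^+ 2)); last first.
      by rewrite ler_pdivrMr ?exprn_gt0 // ler_peMr ?(ltW P0) // exprn_ege1 //; lra.
    by apply: le_trans PX2; have := X_pow 8 isT; rewrite X8; lra.
  nra.
pose q := Num.truncn y.
have y0 : 0 <= y by lra.
have /andP[qy yq] := truncn_itv y0.
have {}yq : y / 2 <= q%:R by move: yq; rewrite -natr1 -/q; lra.
have q0 : (0 < q)%N by rewrite -(ltr0n R); lra.
apply: le_trans qy; rewrite ler_nat.
pose e := near (G := G) k.
(* [s = Delta ^ (t - 1/2)] exceeds [2 * h], of order [Delta ^ (t - 1)], while with
   [l = Delta ^ (t - 1/4)] the failure probability [s / l] is small enough to keep [D * (s / l)] of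
   order [l]. *)
pose s := P / X ^+ 4; pose l := P / X ^+ 2.
have l0 : 0 < l by apply: divr_gt0 P0 (exprn_gt0 _ X0).
have sE : s = X ^+ 4 * Dl ^+ k by rewrite /s /P /t exprS -X8; field; rewrite gt_eqF.
have [c cP] : exists c : {ffun edge G -> 'I_q}, forall g f, e g f -> c g != c f.
  have [] := @colouring_of_sparse_nbrs _ e q (@near_sym G k) (@near_irr G k) R s l
    (2 * Delta.+1 ^ t) (8 * t * Delta.+1 ^ k) (2 * Delta.+1) q0.
  - exact: l0.
  - rewrite sE; have := X_pow 4 isT; move: (X ^+ 4) => X4 HX4; nra.
  - rewrite sE !natrM natrX.
    have K2 : 2 ^+ k <= K by rewrite /K ler_weXn2l //; lra.
    have dk := dP k; have := X_pow 4 isT; move: (X ^+ 4) => X4 HX4.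
    have dk' : (Delta.+1%:R : R) ^+ k <= K * Dl ^+ k.
      by apply: le_trans dk _; rewrite ler_wpM2r //; lra.
    apply: (@le_trans _ _ (16 * t%:R * K * Dl ^+ k)); last by rewrite ler_wpM2r //; lra.
    by rewrite -[leRHS]mulrA !mulrA -[16 * _ * _ * _]mulrA -natrM ler_wpM2l //; lra.
  - by move=> g; apply: card_near.
  - by move=> g; apply: card_crowded.
  (* The right side is at least [(y / 2) / X >= 8 * K * l]. On the left, [m <= 4 * Delta <= l] and
     [D * (s / l) <= 2 * K * l], so the sum is at most [4 * K * l]. *)
  - have lE : P / X ^+ 2 = l by [].
    have slE : s / l = (X ^+ 2)^-1.
      by rewrite /s /l; field; rewrite !gt_eqF.
    rewrite slE !natrM natrX -natr1 -/Dl natr1.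
    have L_ge : 4 * (2 * Delta.+1%:R ^+ t) / q%:R <= L.
      rewrite ler_pdivrMr ?ltr0n //; apply: (@le_trans _ _ (L * (y / 2))).
        have -> : L * (y / 2) = 8 * (K * P) by rewrite yE; field; rewrite gt_eqF.
        by have := dP t; rewrite -/K -/P; lra.
      by rewrite ler_wpM2l // ltW.
    have e_ge : X^-1 <= expR (- (4 * (2 * Delta.+1%:R ^+ t) / q%:R)).
      by rewrite /X -expRN ler_expR lerN2.
    apply: (@le_trans _ _ (8 * K * P / X * X^-1)); last first.
      rewrite ler_pM ?invr_ge0 ?(ltW X0) //; last lra.
      by rewrite mulr_ge0 ?invr_ge0 ?(ltW X0) //; nra.
    have -> : 8 * K * P / X * X^-1 = 8 * K * l by rewrite /l; field; rewrite gt_eqF.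
    have : 2 * Delta.+1%:R ^+ t * (X ^+ 2)^-1 <= 2 * K * l.
      have X2 : 0 <= (X ^+ 2)^-1 by rewrite invr_ge0 sqr_ge0.
      by have := ler_wpM2r X2 (dP t); rewrite -/K -/P -(mulrA K) /l; lra.
    rewrite -lE in l0 *; move: PX2 l0; rewrite -natr1 -/Dl; move: (P / X ^+ 2) => l' ? ?.
    nra.
  by move=> c cP; exists c.
exact: (dist_chromatic_index_near (erefl t) cP).
Qed.
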